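(* Let $K$ be a field of characteristic two, let $K^{\mathrm{alg}}$ be a fixed algebraic closure of $K$, and let $L\subseteq K^{\mathrm{alg}}$ be a Galois extension of $K$ such that $\mathrm{Gal}(L|K)\cong D_4$. Suppose that $F,G,H\in K$ and $q,r,s\in K^{\mathrm{alg}}$ are such that $q^2+q=F$, $r^2+r=Gq+H$ and $s^2+s=G$, and $L$ is the Galois closure over $K$ of $K[q,r]$. Then (1) the degree two subfields of $L$ are $K[q]$, $K[s]$ and $K[q+s]$; (2) the unique degree four normal subfield of $L$ is $K[q,s]$; (3) the non-normal degree four subfields of $L$ containing $K[q]$ are $K[q,r]$ and $K[q,r+s]$; (4) the non-normal degree four subfields of $L$ containing $K[s]$ are $K[s,r+qs]$ and $K[s,r+qs+q]$; and (5) $L=K[q,r,s]$.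
   Context: $D_4$ is the dihedral group of order 8. ''Subfield of $L$'' means intermediate field of $L|K$; degree and normality are taken over $K$. *)

(* Defs.v *)
From mathcomp Require Import all_boot all_order all_algebra.
From mathcomp Require Import all_fingroup all_solvable all_field.

Set Implicit Arguments.
Unset Strict Implicit.
Unset Printing Implicit Defensive.

Import GRing.Theory.
Local Open Scope ring_scope.

(* A field extension inside the algebraic closure Kalg of K is given by a
   finite-dimensional extension M of K together with a field embedding of M
   into Kalg that is compatible with the structure map iota : K -> Kalg. *)

Definition is_algebraic_closure (K : fieldType) (Kalg : closedFieldType)
    (iota : {rmorphism K -> Kalg}) : Prop :=
  forall x : Kalg, algebraicOver iota x.

Definition embedding_over (K : fieldType) (Kalg : closedFieldType)
    (iota : {rmorphism K -> Kalg}) (M : splittingFieldType K)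
    (j : {rmorphism M -> Kalg}) : Prop :=
  forall a : K, j a%:A = iota a.

Definition in_range (M : Type) (Kalg : Type) (j : M -> Kalg) (x : Kalg) : Prop :=
  exists y : M, j y = x.

(* j(L) is the Galois closure of K[xs] in Kalg: the least subfield of Kalg
   that is Galois over K and contains xs. Since the elements of xs are
   algebraic over K, it is enough to compare with finite extensions M. *)
Definition is_galois_closure (K : fieldType) (Kalg : closedFieldType)
    (iota : {rmorphism K -> Kalg}) (L : splittingFieldType K)
    (j : {rmorphism L -> Kalg}) (xs : seq Kalg) : Prop :=
  [/\ galois 1 {:L},
      forall x, x \in xs -> in_range j x
    & forall (M : splittingFieldType K) (jM : {rmorphism M -> Kalg}),
        embedding_over iota jM -> galois 1 {:M} ->
        (forall x, x \in xs -> in_range jM x) ->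
        forall z : L, in_range jM (j z)].

(* Main.v *)
From HB Require Import structures.
Require Import Defs.
From mathcomp Require Import all_boot all_order all_algebra.
From mathcomp Require Import all_fingroup all_solvable all_field.

(* Since r^2 + r = G q + H and q is moved by the Galois group, the difference of
   r and one of its conjugates is a root of X^2 + X = G, so s lies in L. Every
   automorphism then has the form q -> q + a, s -> s + b, r -> r + a s + c with
   a, b, c in F_2. Hence K[q, r, s] is normal, so it is L, and (a, b, c)
   determines the automorphism; as the group has order 8, all triples occur.
   Under this identification the group law is that of the Heisenberg group over
   F_2, and the subgroups of order 2 and 4 and their fixed fields can be read
   off. *)

Set Implicit Arguments.
Unset Strict Implicit.
Unset Printing Implicit Defensive.

Import GRing.Theory.
Local Open Scope ring_scope.

(** * Galois closures seen from inside [L] *)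

(** Minimality of a Galois closure is tested on splitting field types, while a subfield viewed as a
    type is only a field extension. The polynomial split by the image and its roots are pulled back
    along [f] to equip [M0] with the missing structure. *)
Lemma galois_limg (F : fieldType) (L : splittingFieldType F)
    (M0 : fieldExtType F) (f : 'AHom(M0, L)) :
  galois 1 (limg f) ->
  exists (M : splittingFieldType F) (g : 'AHom(M, L)),
    galois 1 {:M} /\ limg g = limg f.
Proof.
case/splitting_galoisField=> p [/polyOver1P[p0 Dp0] sep_p [rs Dp defE]].
pose q : {poly M0} := map_poly (in_alg M0) p0.
have map_q : map_poly f q = p.
  by rewrite Dp0 -map_poly_comp; apply/eq_map_poly=> x; apply: rmorph_alg.
have Kq : q \is a polyOver 1%VS by apply/polyOver1P; exists p0.
have split_q : splittingFieldFor 1 q {:M0}.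
  have [zs Dzs] : {zs | map f zs = rs}.
    exists (map (f^-1)%VF rs); rewrite -map_comp map_id_in // => y rs_y.
    by rewrite /= limg_lfunVK // -defE seqv_sub_adjoin.
  exists zs.
    rewrite -(eqp_map f) map_q (eqp_ltrans Dp) -Dzs big_map rmorph_prod /=.
    under [X in _ %= X]eq_bigr do rewrite rmorphB /= map_polyX map_polyC.
    exact: eqpxx.
  apply/eqP; rewrite -(eq_limg_ker0 _ _ (AHom_lker0 f)).
  by rewrite aimg_adjoin_seq aimg1 Dzs defE.
pose mixin := FieldExt_isSplittingField.Build F M0 (ex_intro2 _ _ q Kq split_q).
pose M : splittingFieldType F := HB.pack M0 mixin.
exists M, f; split=> //; apply/splitting_galoisField; exists q; split=> //.
by rewrite -(separable_map f) map_q.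
Qed.

(** A normal [E] is Galois over [K], hence a competitor in the minimality clause: the image of [L]
    under [j] lies in that of [E], and [j] is injective. *)
Lemma is_galois_closure_full (K : fieldType) (Kalg : closedFieldType)
    (iota : {rmorphism K -> Kalg}) (L : splittingFieldType K)
    (j : {rmorphism L -> Kalg}) (xs : seq L) (E : {subfield L}) :
  embedding_over iota j -> is_galois_closure iota j (map j xs) ->
  normalField 1 E -> {subset xs <= E} -> E = {:L}%AS.
Proof.
move=> jK [galL _ minL] nE sxE.
pose f := linfun (vsval : subvs_of E -> L).
have Df : limg f = E.
  apply/vspaceP=> x; apply/memv_imgP/idP=> [[y _ ->] | Ex].
    by rewrite lfunE /= subvsP.
  by exists (vsproj E x); rewrite ?memvf // lfunE /= vsprojK.
have [|M [g [galM Dg]]] := @galois_limg _ _ _ [the 'AHom(_, _) of f].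
  by rewrite /= Df (normalField_galois galL) // sub1v subvf.
have{Df} Dg : limg g = E by rewrite Dg Df.
have jgK : embedding_over iota (j \o g).
  by move=> a; rewrite /= linearZ /= rmorph1 jK.
apply/val_inj/vspaceP=> z; rewrite memvf.
have [_ /mapP[x xs_x ->]|y /= /fmorph_inj <-] := minL M (j \o g) jgK galM _ z.
  have /memv_imgP[y _ ->] : x \in limg g by rewrite Dg sxE.
  by exists y.
by rewrite -Dg memv_img ?memvf.
Qed.

(** * Automorphisms and adjoined elements *)

Section Galois.

Variables (K : fieldType) (L : splittingFieldType K).
Implicit Types (rs : seq L) (sigma tau : gal_of {:L}).

Lemma mem_gal1 sigma : sigma \in 'Gal({:L} / 1)%g.
Proof. by rewrite gal_kHom ?sub1v // k1AHom. Qed.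

Lemma mem_gal_adjoin rs sigma :
  (sigma \in 'Gal({:L} / <<1 & rs>>)%g) = all (fun x => sigma x == x) rs.
Proof.
rewrite -sub1set galois_connection ?subvf //.
have fixE x : (x \in fixedField [set sigma]) = (sigma x == x).
  apply/(fixedFieldP (memvf x))/eqP=> [-> // | fix_x y /set1P-> //].
  by rewrite set11.
apply/Fadjoin_seqP/allP => [[_ sub] x /sub | fix_rs]; first by rewrite fixE.
by split=> [|x /fix_rs]; rewrite ?sub1v // fixE.
Qed.

Lemma normalField_adjoin rs :
  (forall sigma x, x \in rs -> sigma x \in <<1 & rs>>%VS) ->
  normalField 1 <<1 & rs>>.
Proof.
move=> stab; apply/forall_inP=> g _.
(* Automorphisms preserve dimension, so one inclusion suffices. *)
rewrite eqEdim limg_dim_eq ?(eqP (AEnd_lker0 g)) ?capv0 // leqnn andbT.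
rewrite aimg_adjoin_seq aimg1; apply/Fadjoin_seqP; split=> [|_ /mapP[x xrs ->]].
  exact: sub1v.
by have := stab (gal {:L} g) x xrs; rewrite galK ?memvf ?subvf.
Qed.

Lemma gal_adjoin_inj rs sigma tau :
  <<1 & rs>>%AS = {:L}%AS -> {in rs, sigma =1 tau} -> sigma = tau.
Proof.
move=> full eq_rs; apply/eqP; rewrite eq_mulgV1; apply/eqP.
have: (sigma * tau^-1)%g \in 'Gal({:L} / <<1 & rs>>)%g.
  rewrite mem_gal_adjoin; apply/allP=> x /eq_rs eq_x.
  by rewrite galM ?memvf // eq_x -galM ?memvf // mulgV gal_id.
move: (_ * _)%g => rho; rewrite -[<<1 & rs>>%VS]/(val <<1 & rs>>%AS) full.
move=> rho_fix; apply/eqP/gal_eqP=> x Lx.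
by rewrite gal_id (fixed_gal _ rho_fix).
Qed.

End Galois.

(** * Artin-Schreier equations in characteristic two *)

Lemma sqrrD_pchar2 (R : comNzRingType) (x y : R) :
  2%N \in [pchar R] -> (x + y) ^+ 2 = x ^+ 2 + y ^+ 2.
Proof. by move=> R2; rewrite sqrrD -mulr_natr (pcharf0 R2) mulr0 addr0. Qed.

(** The difference [d] of two roots satisfies [d (d + 1) = 0], so it is 0 or 1; the boolean test
    records which. *)
Lemma artin_schreier_eq (R : idomainType) (x y : R) :
  2%N \in [pchar R] -> x ^+ 2 + x = y ^+ 2 + y -> y = x + (y != x)%:R.
Proof.
move=> R2; have [d ->] : exists d, y = x + d.
  by exists (y - x); rewrite addrC subrK.
rewrite -subr_eq0 addrAC subrr add0r sqrrD_pchar2 //.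
rewrite addrACA -[LHS]addr0 => /addrI/esym/eqP.
rewrite -[d in _ + d]mulr1 expr2 -mulrDr mulf_eq0 addr_eq0 oppr_pchar2 //.
by case/pred2P=> ->; rewrite ?eqxx ?oner_eq0.
Qed.

(** * A root of [X^2 + X = G] in [L] *)

Section Tower.

Variables (K : fieldType) (L : splittingFieldType K) (F G H : K) (q r : L).
Hypotheses (charL2 : 2%N \in [pchar L])
  (card_gal : #|'Gal({:L} / 1)%g| = 8%N)
  (Dq : q ^+ 2 + q = F%:A) (Dr : r ^+ 2 + r = G%:A * q + H%:A)
  (closL : forall E : {subfield L},
     normalField 1 E -> q \in E -> r \in E -> E = {:L}%AS).
Implicit Types (sigma tau : gal_of {:L}) (E : {subfield L}).

Let gal_scalar sigma (a : K) : sigma a%:A = a%:A.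
Proof. by rewrite linearZ /= rmorph1. Qed.

Let gal_q sigma : sigma q = q + (sigma q != q)%:R.
Proof.
apply: artin_schreier_eq => //.
by rewrite Dq -(gal_scalar sigma) -Dq rmorphD rmorphXn.
Qed.

Let card_galT : #|{: gal_of {:L}}| = 8%N.
Proof.
by rewrite -card_gal -cardsT; apply/eq_card=> sigma; rewrite inE mem_gal1.
Qed.

Lemma exists_artin_schreier : exists t : L, t ^+ 2 + t = G%:A.
Proof.
have gal_r sigma : (sigma r) ^+ 2 + sigma r = G%:A * sigma q + H%:A.
  by rewrite -rmorphXn -rmorphD Dr rmorphD rmorphM /= !gal_scalar.
case: (pickP (fun sigma => sigma q != q)) => [sigma q_moved | fix_q].
  exists (sigma r + r).
  rewrite sqrrD_pchar2 // addrACA gal_r Dr gal_q.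
  rewrite q_moved mulrDr mulr1 addrACA (addrAC _ G%:A).
  by rewrite !(addrr_pchar2 charL2) add0r addr0.
(* If every automorphism fixes [q], then [K[q, r]] is normal, hence equal to [L], and an
   automorphism is determined by whether it moves [r]. That allows at most 2 of them, not 8. *)
have {gal_r}gal_r sigma : sigma r = r + (sigma r != r)%:R.
  apply: artin_schreier_eq => //; rewrite gal_r Dr.
  by have /negbFE/eqP-> := fix_q sigma.
have full : <<1 & [:: q; r]>>%AS = {:L}%AS.
  apply: closL; rewrite /= ?seqv_sub_adjoin ?inE ?eqxx ?orbT //.
  apply: normalField_adjoin => sigma x; rewrite !inE => /pred2P[]->.
    by rewrite gal_q rpredD ?rpred_nat ?seqv_sub_adjoin ?inE ?eqxx.
  by rewrite gal_r rpredD ?rpred_nat ?seqv_sub_adjoin ?inE ?eqxx ?orbT.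
have /leq_card : injective (fun sigma => sigma r != r).
  move=> sigma tau eq_r; apply: (gal_adjoin_inj full) => x.
  rewrite !inE => /pred2P[]->; last by rewrite gal_r eq_r -gal_r.
  by have /negbFE/eqP-> := fix_q sigma; have /negbFE/eqP-> := fix_q tau.
by rewrite card_galT card_bool.
Qed.

(** * Automorphisms coded by three bits *)

Variable s : L.
Hypothesis Ds : s ^+ 2 + s = G%:A.

Let gal_s sigma : sigma s = s + (sigma s != s)%:R.
Proof.
apply: artin_schreier_eq => //.
by rewrite Ds -(gal_scalar sigma) -Ds rmorphD rmorphXn.
Qed.

(* The bits (a, b, c) of q -> q + a, s -> s + b, r -> r + a s + c. *)
Definition code sigma : bool * bool * bool :=
  (sigma q != q, sigma s != s, sigma r != r + (sigma q != q)%:R * s).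

(** With [a] the bit of [q], both [sigma r] and [r + a s] are roots of [X^2 + X = G (q + a) + H],
    because [(a s)^2 + a s = a G]. *)
Let gal_r sigma : sigma r = r + (code sigma).1.1%:R * s + (code sigma).2%:R.
Proof.
rewrite /code /=; apply: artin_schreier_eq => //.
rewrite -rmorphXn -rmorphD Dr rmorphD rmorphM /= !gal_scalar.
move: (gal_q sigma); set b := (_ != q) => ->; rewrite sqrrD_pchar2 //.
rewrite exprMn addrACA Dr mulrDr addrAC; congr (_ + _).
case: b => /=; last by rewrite expr0n !mul0r add0r mulr0.
by rewrite expr1n !mul1r Ds mulr1.
Qed.

Let codeP sigma : [/\ sigma q = q + (code sigma).1.1%:R,
  sigma s = s + (code sigma).1.2%:R
  & sigma r = r + (code sigma).1.1%:R * s + (code sigma).2%:R].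
Proof. by split. Qed.

Lemma adjoin_qrs : <<1 & [:: q; r; s]>>%AS = {:L}%AS.
Proof.
have [Eq Er Es] : [/\ q \in <<1 & [:: q; r; s]>>%VS,
    r \in <<1 & [:: q; r; s]>>%VS & s \in <<1 & [:: q; r; s]>>%VS].
  by split; apply: seqv_sub_adjoin; rewrite !inE eqxx ?orbT.
apply: closL => //; apply: normalField_adjoin => sigma x.
rewrite !inE => /or3P[]/eqP->.
- by rewrite gal_q rpredD ?rpred_nat.
- by rewrite gal_r rpredD ?rpred_nat // rpredD // rpredM ?rpred_nat.
- by rewrite gal_s rpredD ?rpred_nat.
Qed.

Lemma code_inj : injective code.
Proof.
move=> sigma tau eq_code; apply: (gal_adjoin_inj adjoin_qrs) => x.
have [q1 s1 r1] := codeP sigma; have [q2 s2 r2] := codeP tau.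
by rewrite !inE => /or3P[]/eqP->; rewrite (q1, s1, r1) (q2, s2, r2) eq_code.
Qed.

Lemma code_surj x : exists sigma, code sigma = x.
Proof.
have [|f _ fK] := inj_card_bij code_inj.
  by rewrite card_galT !card_prod card_bool.
by exists (f x).
Qed.

Local Notation code0 := (false, false, false).

(** The product of unitriangular 3 by 3 matrices over F_2 with [a], [b] above the diagonal and [c]
    in the corner. *)
Definition code_mul (x y : bool * bool * bool) : bool * bool * bool :=
  (x.1.1 (+) y.1.1, x.1.2 (+) y.1.2, x.2 (+) y.2 (+) (x.1.1 && y.1.2)).

Let natr_addb (b c : bool) : (b (+) c)%:R = b%:R + c%:R :> L.
Proof. by case: b c => [] []; rewrite ?addr0 ?add0r ?(addrr_pchar2 charL2). Qed.

Let natr_bool_inj (b c : bool) : b%:R = c%:R :> L -> b = c.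
Proof.
by case: b c => [] [] //= /eqP; rewrite ?(eq_sym 0) oner_eq0.
Qed.

(** The left factor acts first, so [r] goes to [tau (r + a s + c) = r + (a' + a) s + (c' + a b' +
    c)]; the cross term [a b'] comes from moving [s]. *)
Lemma codeM sigma tau : code (sigma * tau)%g = code_mul (code sigma) (code tau).
Proof.
have := (codeP sigma, codeP tau, codeP (sigma * tau)%g).
case: (code sigma) (code tau) (code (sigma * tau)%g) => [[a b] c] [[a' b'] c'].
move=> [[a'' b''] c''] /= [[[q1 s1 r1] [q2 s2 r2]] []].
rewrite !galM ?memvf // q1 s1 r1 !rmorphD rmorphM !rmorph_nat /= q2 s2 r2.
rewrite -!addrA => /addrI; rewrite -natr_addb => /natr_bool_inj Ea.
move=> /addrI; rewrite -natr_addb => /natr_bool_inj Eb.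
rewrite -{}Ea -{}Eb natr_addb mulrDl -addrA => /addrI/addrI.
rewrite addrCA mulrDr -addrA => /addrI.
rewrite -natrM mulnb -!natr_addb => /natr_bool_inj <-.
by rewrite /code_mul /= (addbC a') (addbC b') (addbC c') (addbC (a && b')).
Qed.

(** * Subfields as sets of codes *)

(** Transporting the Galois group of [E] to the eight triples turns questions about subfields into
    finite case checks. *)
Definition codes (E : {subfield L}) := code @: 'Gal({:L} / E)%g.

Lemma mem_codes sigma E :
  (code sigma \in codes E) = (sigma \in 'Gal({:L} / E)%g).
Proof. exact/mem_imset/code_inj. Qed.

Hypothesis galL : galois 1 {:L}.

Let galoisE (E : {subfield L}) : galois E {:L}.
Proof. by apply: galoisS galL; rewrite sub1v subvf. Qed.

Lemma card_codes E : (#|codes E| * \dim E = 8)%N.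
Proof.
rewrite card_imset; last exact: code_inj.
rewrite -(galois_dim (galoisE E)) -card_gal -(galois_dim galL) dimv1 divn1.
by rewrite divnK // field_dimS ?subvf.
Qed.

(** By the Galois correspondence, [E] is the fixed field of its group. Subfields are identified
    below by comparing codes. *)
Lemma codes_inj : injective codes.
Proof.
move=> E M /(imset_inj code_inj) eq_gal; apply/val_inj => /=.
have /galois_fixedField <- := galoisE E; rewrite eq_gal.
exact/galois_fixedField.
Qed.

Lemma codes_fixed E (u : L) :
  u \in E <-> (forall sigma, code sigma \in codes E -> sigma u = u).
Proof.
have /galois_fixedField{1}<- := galoisE E.
split=> [/(fixedFieldP (memvf u)) fix_u sigma | fix_u].
  by rewrite mem_codes => /fix_u.
by apply/(fixedFieldP (memvf u)) => sigma; rewrite -mem_codes => /fix_u.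
Qed.

Lemma code1 : code 1%g = code0.
Proof. by rewrite /code !gal_id !eqxx mul0r addr0 eqxx. Qed.

Lemma codes1 E : code0 \in codes E.
Proof. by rewrite -code1 mem_codes group1. Qed.

Lemma codes_mul E x y :
  x \in codes E -> y \in codes E -> code_mul x y \in codes E.
Proof.
have [[sigma <-] [tau <-]] := (code_surj x, code_surj y).
by rewrite -codeM !mem_codes; apply: groupM.
Qed.

(** The condition [a || b] says that the element is not central. Its commutator with [(a', b', c')]
    has corner bit [a b' + a' b], which is 1 for [a' = ~~ a] and [b' = a], so conjugation flips [c]
    alone. *)
Lemma codes_normal E a b c : normalField 1 E ->
  (a, b, c) \in codes E -> a || b -> (a, b, ~~ c) \in codes E.
Proof.
move=> nE; have [sigma Dsigma] := code_surj (a, b, c).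
(* tau does not commute with sigma *)
have [tau Dtau] := code_surj (~~ a, a, false).
have nGal : ('Gal({:L} / E) <| 'Gal({:L} / 1))%g.
  by apply: normalField_normal => //; rewrite sub1v subvf.
have normE := subsetP (normal_norm nGal) tau (mem_gal1 _).
rewrite -{1}Dsigma mem_codes -(memJ_norm _ normE).
(* The relation [sigma tau = tau (sigma ^ tau)] is solved for the code of the conjugate. *)
have := codeM tau (sigma ^ tau)%g; rewrite -conjgC codeM Dsigma Dtau -mem_codes.
case: (code _) => [[a' b'] c'].
by case: a b c a' b' c' {Dsigma Dtau} => [] [] [] [] [] [].
Qed.

(** Modulo the centre, a group of order 4 has at most one non-trivial class: [(0, 1)] fixes [q],
    [(1, 0)] fixes [s], and [(1, 1)] fixes [q + s]. *)
Lemma codes_dim2 E : \dim E = 2%N ->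
  [\/ q \in E, s \in E | q + s \in E].
Proof.
move=> dimE; have card4 : #|codes E| = 4%N.
  by apply/eqP; rewrite -(@eqn_pmul2r 2) // -{1}dimE card_codes.
(* If x and y are non-trivial and distinct modulo the centre, they do not
   commute, so 1, x, y, x y and y x are five distinct elements. *)
have max4 x y : x \in codes E -> y \in codes E ->
    x.1 != (false, false) -> y.1 != (false, false) -> x.1 = y.1.
  pose z5 := [:: code0; x; y; code_mul x y; code_mul y x].
  move=> Ex Ey; have sub : {subset z5 <= enum (codes E)}.
    move=> z; rewrite mem_enum !inE.
    by case/or4P=> [|||/orP[]]/eqP->; rewrite ?codes1 ?codes_mul.
  have := @uniq_leq_size _ z5 (enum (codes E)) ^~ sub.
  rewrite -cardE card4 /z5 {z5 sub}.
  move: x y {Ex Ey} => [[a b] c] [[a' b'] c'].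
  by case: a b c a' b' c' => [] [] [] [] [] [] //= /(_ isT).
case: (pickP [pred x in codes E | x.1 != (false, false)]) => [w | none].
  case/andP=> Ew w_neq0.
  have im x : x \in codes E -> x.1 = (false, false) \/ x.1 = w.1.
    by move=> Ex; have [|/max4-/(_ w)->] := eqVneq x.1 (false, false); auto.
  case: w w_neq0 im {Ew} => [[[] []] c] //= _ im.
  - apply: Or33; apply/codes_fixed=> sigma /im.
    have [q1 s1 _] := codeP sigma; move: q1 s1; rewrite rmorphD.
    case: (code sigma) => -[a b] d /= -> -> Eab; rewrite addrACA.
    case: a b Eab => [] [] [] //=; by rewrite ?(addrr_pchar2 charL2) !addr0.
  - apply: Or32; apply/codes_fixed=> sigma /im; have [_ -> _] := codeP sigma.
    by case: (code sigma) => -[[] []] ? [] //=; rewrite addr0.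
  - apply: Or31; apply/codes_fixed=> sigma /im; have [-> _ _] := codeP sigma.
    by case: (code sigma) => -[[] []] ? [] //=; rewrite addr0.
(* All codes are central here, so [q] is fixed. Cardinality would exclude this case, but the
   conclusion holds anyway. *)
apply: Or31; apply/codes_fixed=> sigma Esigma; have [-> _ _] := codeP sigma.
move: Esigma (none (code sigma)); case: (code sigma) => -[a b] d /= ->.
by case: a b => [] [] //=; rewrite addr0.
Qed.

(** * The degree four subfields and their groups of order two *)

Let addb_eq (u : L) (b : bool) : (u + b%:R == u) = ~~ b.
Proof.
by rewrite -subr_eq0 addrAC subrr add0r; case: b; rewrite ?eqxx ?oner_eq0.
Qed.

Lemma codes_adjoin rs sigma :
  (code sigma \in codes <<1 & rs>>%AS) = all (fun u => sigma u == u) rs.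
Proof. by rewrite mem_codes mem_gal_adjoin. Qed.

Lemma codes_qs :
  codes <<1 & [:: q; s]>>%AS = [set code0; (false, false, true)].
Proof.
apply/setP=> x; have [sigma <-] := code_surj x; rewrite codes_adjoin /= !inE.
have [-> -> _] := codeP sigma; rewrite !addb_eq.
by case: (code sigma) => [[[] []] []].
Qed.

Lemma codes_qr :
  codes <<1 & [:: q; r]>>%AS = [set code0; (false, true, false)].
Proof.
apply/setP=> x; have [sigma <-] := code_surj x; rewrite codes_adjoin /= !inE.
have [-> _ ->] := codeP sigma; rewrite addb_eq.
case: (code sigma) => [[[] b] d] //=.
by rewrite mul0r addr0 addb_eq; case: b d => [] [].
Qed.

Lemma codes_q_rs :
  codes <<1 & [:: q; r + s]>>%AS = [set code0; (false, true, true)].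
Proof.
apply/setP=> x; have [sigma <-] := code_surj x; rewrite codes_adjoin /= !inE.
rewrite rmorphD /=; have [-> -> ->] := codeP sigma; rewrite addb_eq.
case: (code sigma) => [[[] b] d] //=.
rewrite mul0r addr0 addrACA -natr_addb addb_eq.
by case: b d => [] [].
Qed.

(** The term [q s] is chosen so that its shift [a s] cancels the shift [a s] of [r], leaving only
    [c]. *)
Let gal_rqs sigma : sigma s = s ->
  sigma (r + q * s) = r + q * s + (code sigma).2%:R.
Proof.
have [q1 _ r1] := codeP sigma; move: q1 r1.
case: (code sigma) => [[a b] d] /= q1 r1 fix_s.
rewrite rmorphD rmorphM /= fix_s q1 r1.
rewrite mulrDl addrACA (addrAC r) (addrC d%:R) addrA.
by rewrite -(addrA (r + _)) (addrr_pchar2 charL2) addr0.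
Qed.

Lemma codes_s_rqs :
  codes <<1 & [:: s; r + q * s]>>%AS = [set code0; (true, false, false)].
Proof.
apply/setP=> x; have [sigma <-] := code_surj x; rewrite codes_adjoin !inE.
have := @gal_rqs sigma; have [_ fix_s _] := codeP sigma; move: fix_s.
case: (code sigma) => [[a b] d] /=; rewrite andbT => -> fix_rqs.
rewrite addb_eq; case: b fix_rqs => [no_fix | fix_rqs] /=.
  by case: a d {no_fix} => [] [].
by rewrite fix_rqs ?addr0 // addb_eq; case: a d {fix_rqs} => [] [].
Qed.

(** Adding [q] changes the shift from [c] to [c + a], which vanishes when [c = a]. *)
Lemma codes_s_rqsq :
  codes <<1 & [:: s; r + q * s + q]>>%AS = [set code0; (true, false, true)].
Proof.
apply/setP=> x; have [sigma <-] := code_surj x; rewrite codes_adjoin !inE.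
have := @gal_rqs sigma; have [gq fix_s _] := codeP sigma; move: gq fix_s.
case: (code sigma) => [[a b] d] /=.
rewrite andbT (rmorphD _ _ q) => /= -> -> fix_rqs.
rewrite addb_eq; case: b fix_rqs => [no_fix | fix_rqs] /=.
  by case: a d {no_fix} => [] [].
rewrite fix_rqs ?addr0 // addrACA -natr_addb addb_eq.
by case: a d {fix_rqs} => [] [].
Qed.

Lemma codes_dim4 E :
  \dim E = 4%N <-> exists2 x, x != code0 &
    codes E = [set code0; x].
Proof.
split=> [dimE | [x x_neq0 DE]]; last first.
  have := card_codes E; rewrite DE cards2 eq_sym x_neq0 /= => card_E.
  by apply/eqP; rewrite -(@eqn_pmul2l 2) // card_E.
have /eqP/cards2P[x [y [neq_xy DE]]] : #|codes E| = 2%N.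
  by apply/eqP; rewrite -(@eqn_pmul2r 4) // -{1}dimE card_codes.
have := codes1 E; rewrite DE !inE => /pred2P[] E0; move: neq_xy DE;
  rewrite -{}E0 => neq_xy DE.
  by exists y; rewrite // eq_sym.
by exists x; rewrite // setUC.
Qed.

(** A non-central [x] would bring its conjugate with flipped last bit into the group, a third
    element. *)
Lemma codes_normal4 E x : x != code0 ->
  codes E = [set code0; x] -> normalField 1 E ->
  x = (false, false, true).
Proof.
case: x => [[a b] c] x_neq0 DE nE.
have := codes_normal nE (a := a) (b := b) (c := c).
rewrite DE !inE eqxx orbT => /(_ isT).
by case: a b c x_neq0 {nE DE} => [] [] [] //= _ /(_ isT).
Qed.

Lemma normal_qs : normalField 1 <<1 & [:: q; s]>>.
Proof.
apply: normalField_adjoin => sigma x; rewrite !inE => /pred2P[]->.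
  by rewrite gal_q rpredD ?rpred_nat ?seqv_sub_adjoin ?inE ?eqxx.
by rewrite gal_s rpredD ?rpred_nat ?seqv_sub_adjoin ?inE ?eqxx ?orbT.
Qed.

Lemma codes_center E :
  codes E = [set code0; (false, false, true)] -> normalField 1 E.
Proof. by rewrite -codes_qs => /codes_inj->; apply: normal_qs. Qed.

Lemma normal_dim4P E :
  \dim E = 4%N /\ normalField 1 E <-> E = <<1 & [:: q; s]>>%AS.
Proof.
split=> [[/codes_dim4[x x_neq0 DE] nE] | ->].
  by apply: codes_inj; rewrite codes_qs DE (codes_normal4 x_neq0 DE nE).
split; last exact: normal_qs.
by apply/codes_dim4; exists (false, false, true); rewrite ?codes_qs.
Qed.

Lemma nonnormal_codes E x : x.1 != (false, false) ->
  codes E = [set code0; x] ->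
  \dim E = 4%N /\ ~~ normalField 1 E.
Proof.
case: x => [[a b] c] /= ab DE.
have x_neq0 : (a, b, c) != code0 by case: a b ab {DE} => [] [].
split; first by apply/codes_dim4; exists (a, b, c).
by apply/negP=> /(codes_normal4 x_neq0 DE)[Ea Eb _]; rewrite Ea Eb in ab.
Qed.

(** Containing [q] forces [a = 0] in the non-trivial code, and non-normality excludes the central
    one; [(0, 1, 0)] and [(0, 1, 1)] remain. *)
Lemma nonnormal_dim4_qP E :
  [/\ \dim E = 4%N, ~~ normalField 1 E & (<<1; q>> <= E)%VS] <->
  (E = <<1 & [:: q; r]>>%AS \/ E = <<1 & [:: q; r + s]>>%AS).
Proof.
split=> [[/codes_dim4[x x_neq0 DE] nE] | ].
  rewrite sub_adjoin1v => Eq.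
  have [sigma Dsigma] := code_surj x.
  have x_q : ~~ x.1.1.
    rewrite -(addb_eq q) -Dsigma; have [<- _ _] := codeP sigma.
    by apply/eqP/(proj1 (codes_fixed E q) Eq); rewrite DE !inE Dsigma eqxx orbT.
  have x_z : x != (false, false, true).
    by apply: contraNneq nE => Dx; apply: codes_center; rewrite DE Dx.
  move: x x_neq0 DE x_q x_z {sigma Dsigma nE} => [[[] []] []] // _ DE _ _.
    by right; apply: codes_inj; rewrite codes_q_rs.
  by left; apply: codes_inj; rewrite codes_qr.
have q_in u : (<<1; q>> <= <<1 & [:: q; u]>>)%VS.
  by rewrite sub_adjoin1v seqv_sub_adjoin ?inE ?eqxx.
by case=> ->; [have [] := nonnormal_codes _ codes_qr
  | have [] := nonnormal_codes _ codes_q_rs] => // dimE nE; split=> //;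
  apply: q_in.
Qed.

(** Here [s] forces [b = 0], leaving [(1, 0, 0)] and [(1, 0, 1)]. *)
Lemma nonnormal_dim4_sP E :
  [/\ \dim E = 4%N, ~~ normalField 1 E & (<<1; s>> <= E)%VS] <->
  (E = <<1 & [:: s; r + q * s]>>%AS \/ E = <<1 & [:: s; r + q * s + q]>>%AS).
Proof.
split=> [[/codes_dim4[x x_neq0 DE] nE] | ].
  rewrite sub_adjoin1v => Es.
  have [sigma Dsigma] := code_surj x.
  have x_s : ~~ x.1.2.
    rewrite -(addb_eq s) -Dsigma; have [_ <- _] := codeP sigma.
    by apply/eqP/(proj1 (codes_fixed E s) Es); rewrite DE !inE Dsigma eqxx orbT.
  have x_z : x != (false, false, true).
    by apply: contraNneq nE => Dx; apply: codes_center; rewrite DE Dx.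
  move: x x_neq0 DE x_s x_z {sigma Dsigma nE} => [[[] []] []] // _ DE _ _.
    by right; apply: codes_inj; rewrite codes_s_rqsq.
  by left; apply: codes_inj; rewrite codes_s_rqs.
have s_in u : (<<1; s>> <= <<1 & [:: s; u]>>)%VS.
  by rewrite sub_adjoin1v seqv_sub_adjoin ?inE ?eqxx.
by case=> ->; [have [] := nonnormal_codes _ codes_s_rqs
  | have [] := nonnormal_codes _ codes_s_rqsq] => // dimE nE; split=> //;
  apply: s_in.
Qed.

(** * The degree two subfields *)

Lemma dim_artin_schreier (u : L) (c : K) :
  u ^+ 2 + u = c%:A -> u \notin 1%VS -> \dim <<1; u>> = 2%N.
Proof.
move=> Du u_notin1; pose p : {poly L} := 'X^2 + ('X - c%:A%:P).
have size_p : size p = 3%N by rewrite size_polyDl size_polyXn // size_XsubC.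
have : (size (minPoly 1 u) <= 3)%N.
  rewrite -size_p dvdp_leq ?minPoly_dvdp -?size_poly_eq0 ?size_p //.
    by rewrite rpredD ?rpredX ?polyOverX // polyOverXsubC rpredZ ?rpred1.
  by rewrite rootE !hornerE /= Du subrr.
have := adjoin_deg_eq1 1%AS u.
rewrite (negPf u_notin1) (dim_Fadjoin 1%AS) dimv1 muln1.
(* The degree is a successor by definition. Degree 1 would put [u] in [K], and degree above 2 would
   contradict the bound 3 on the size, which is the degree plus one. *)
by rewrite size_minPoly /adjoin_degree; case: (_.-1) => [|[|]].
Qed.

Lemma dim2P E : \dim E = 2%N <->
  [\/ E = <<1; q>>%AS, E = <<1; s>>%AS | E = <<1; q + s>>%AS].
Proof.
have notin1 (u : L) sigma : sigma u != u -> u \notin 1%VS.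
  by apply: contraNN => /vlineP[a ->]; rewrite gal_scalar.
have dim_q : \dim <<1; q>> = 2%N.
  apply: dim_artin_schreier Dq _.
  have [sigma Dsigma] := code_surj (true, false, false).
  apply: (notin1 _ sigma); have [-> _ _] := codeP sigma.
  by rewrite Dsigma addb_eq.
have dim_s : \dim <<1; s>> = 2%N.
  apply: dim_artin_schreier Ds _.
  have [sigma Dsigma] := code_surj (false, true, false).
  apply: (notin1 _ sigma); have [_ -> _] := codeP sigma.
  by rewrite Dsigma addb_eq.
have dim_qs : \dim <<1; q + s>> = 2%N.
  apply: (@dim_artin_schreier _ (F + G)).
    rewrite sqrrD_pchar2 // addrACA Dq Ds.
    by rewrite scalerDl.
  (* An automorphism that moves [q] and fixes [s] moves [q + s]. *)
  have [sigma Dsigma] := code_surj (true, false, false).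
  apply: (notin1 _ sigma); have [q1 s1 _] := codeP sigma.
  rewrite rmorphD /= q1 s1.
  by rewrite Dsigma addr0 addrAC addb_eq.
split=> [dimE | [] -> //].
have eqE u : u \in E -> \dim <<1; u>> = 2%N -> E = <<1; u>>%AS.
  move=> Eu dim_u; apply/val_inj/esym/eqP.
  by rewrite eqEdim /= sub_adjoin1v Eu dim_u dimE.
by case: (codes_dim2 dimE) => /eqE DE;
  [apply: Or31 | apply: Or32 | apply: Or33];
  apply: DE.
Qed.

End Tower.

(** * Transfer from the algebraic closure to [L] *)

Theorem proposition4p2 (K : fieldType) (charK2 : 2%N \in [pchar K])
    (Kalg : closedFieldType) (iota : {rmorphism K -> Kalg})
    (Kalg_closure : is_algebraic_closure iota)
    (L : splittingFieldType K) (j : {rmorphism L -> Kalg})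
    (jK : embedding_over iota j)
    (galL : galois 1 {:L}) (galL_D4 : ('Gal({:L} / 1) \isog 'D_8)%g)
    (F G H : K) (q r s : Kalg)
    (Dq : q ^+ 2 + q = iota F)
    (Dr : r ^+ 2 + r = iota G * q + iota H)
    (Ds : s ^+ 2 + s = iota G)
    (closL : is_galois_closure iota j [:: q; r]) :
  exists q0 r0 s0 : L,
    [/\ j q0 = q, j r0 = r & j s0 = s] /\
    [/\ (* (1) *)
        forall E : {subfield L},
          \dim E = 2%N <->
          [\/ E = <<1; q0>>%AS, E = <<1; s0>>%AS | E = <<1; q0 + s0>>%AS],
        (* (2) *)
        forall E : {subfield L},
          (\dim E = 4%N /\ normalField 1 E) <-> E = <<1 & [:: q0; s0]>>%AS,
        (* (3) *)
        forall E : {subfield L},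
          [/\ \dim E = 4%N, ~~ normalField 1 E & (<<1; q0>> <= E)%VS] <->
          (E = <<1 & [:: q0; r0]>>%AS \/ E = <<1 & [:: q0; r0 + s0]>>%AS),
        (* (4) *)
        forall E : {subfield L},
          [/\ \dim E = 4%N, ~~ normalField 1 E & (<<1; s0>> <= E)%VS] <->
          (E = <<1 & [:: s0; r0 + q0 * s0]>>%AS \/
           E = <<1 & [:: s0; r0 + q0 * s0 + q0]>>%AS)
      & (* (5) *)
        {:L}%AS = <<1 & [:: q0; r0; s0]>>%AS].
Proof.
have [_ in_j _] := closL.
have [|q0 Dq0] := in_j q; first by rewrite !inE eqxx.
have [|r0 Dr0] := in_j r; first by rewrite !inE eqxx orbT.
move: Dq Dr closL; rewrite -Dq0 -Dr0 => {}Dq {}Dr {}closL.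
have charL2 : 2%N \in [pchar L] by apply: (rmorph_pchar (in_alg L)).
have Dq_L : q0 ^+ 2 + q0 = F%:A.
  by apply: (fmorph_inj j); rewrite jK rmorphD rmorphXn.
have Dr_L : r0 ^+ 2 + r0 = G%:A * q0 + H%:A.
  by apply: (fmorph_inj j); rewrite !rmorphD rmorphXn rmorphM /= !jK.
have card_gal : #|'Gal({:L} / 1)%g| = 8%N.
  by rewrite (card_isog galL_D4) (@card_2dihedral 3).
have full (E : {subfield L}) :
    normalField 1 E -> q0 \in E -> r0 \in E -> E = {:L}%AS.
  move=> nE Eq Er.
  apply: (is_galois_closure_full (xs := [:: q0; r0]) jK closL nE).
  by move=> x; rewrite !inE => /pred2P[]->.
have [s0 [Ds0 Ds_L]] : exists s0, j s0 = s /\ s0 ^+ 2 + s0 = G%:A.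
  have [t Dt] := exists_artin_schreier charL2 card_gal Dq_L Dr_L full.
  (* The given [s] and [j t] are roots of the same equation, so they differ by a bit, and that bit
     already lies in [L]. *)
  have Ds_t : s = j (t + (s != j t)%:R).
    rewrite rmorphD rmorph_nat; apply: artin_schreier_eq.
      exact: (rmorph_pchar iota).
    by rewrite Ds -rmorphXn -rmorphD Dt jK.
  exists (t + (s != j t)%:R); split=> //.
  by apply: (fmorph_inj j); rewrite jK rmorphD rmorphXn -Ds_t.
exists q0, r0, s0; split=> //; split=> [E|E|E|E|].
- exact: (dim2P charL2 card_gal Dq_L Dr_L full Ds_L galL).
- exact: (normal_dim4P charL2 card_gal Dq_L Dr_L full Ds_L galL).
- exact: (nonnormal_dim4_qP charL2 card_gal Dq_L Dr_L full Ds_L galL).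
- exact: (nonnormal_dim4_sP charL2 card_gal Dq_L Dr_L full Ds_L galL).
- by rewrite (adjoin_qrs charL2 Dq_L Dr_L full Ds_L).
Qed.
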